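(* Let $q$ be a power of an odd prime, and let $\mathrm{Tr},\mathrm{N}:\mathbb F_{q^4}\to\mathbb F_{q^2}$ be the trace and norm functions $\mathrm{Tr}(z)=z+z^{q^2}$ and $\mathrm{N}(z)=z^{q^2+1}$. For $a,b\in\mathbb F_{q^4}^*$, the function $x\mapsto x^{q^3+q}+ax^{q^2+1}+bx^2$ is planar on $\mathbb F_{q^4}$ if one of the following two conditions holds: (1) $\mathrm{Tr}(a)\ne0$, $\mathrm{N}(b)=\mathrm{N}(a)-\mathrm{Tr}(a)^{1-q}$, $1-4\,\mathrm{Tr}(a)^{-1-q}$ is a nonzero square in $\mathbb F_q$, and $\mathrm{N}(b)\mathrm{Tr}(a)$ is a nonzero square in $\mathbb F_{q^2}$; or (2) $\mathrm{Tr}(a)=0$, and there exists $\theta\in\mathbb F_{q^2}^*$ such that $\theta^{\frac{q^2-1}2}=(-1)^{\frac{q-1}2}$, $\mathrm{N}(b)=\mathrm{N}(a)-\theta^{1-q}$, and $\mathrm{N}(b)\theta$ is a nonzero square in $\mathbb F_{q^2}$.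
   Context: $\mathbb F_{q^4}$ is the finite field with $q^4$ elements, an extension of $\mathbb F_q$ of degree $4$, with $q$ odd; $\mathbb F_{q^2}$ is its subfield with $q^2$ elements; a superscript $*$ denotes the set of nonzero elements. The trace and norm here are those from $\mathbb F_{q^4}$ to $\mathbb F_{q^2}$ (not to $\mathbb F_q$). A function $f:\mathbb F_{q^4}\to\mathbb F_{q^4}$ is called planar on $\mathbb F_{q^4}$ if for every $c\in\mathbb F_{q^4}^*$ the map $x\mapsto f(x+c)-f(x)$ is a permutation of $\mathbb F_{q^4}$. *)

(* Defs.v *)
From HB Require Import structures.
From mathcomp Require Import all_boot all_order all_algebra all_field.

Set Implicit Arguments.
Unset Strict Implicit.
Unset Printing Implicit Defensive.

Import GRing.Theory.
Local Open Scope ring_scope.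

(* F_q is a finite field Fq with q elements and F_{q^4} is an extension L of Fq
   of dimension 4; its subfield F_{q^2} is the K : {subfield L} of dimension 2,
   and F_q inside L is the subfield 1%AS. *)

Definition planar (R : nzRingType) (f : R -> R) : Prop :=
  forall c : R, c != 0 -> bijective (fun x : R => f (x + c) - f x).

(* Trace and norm from F_{q^4} to F_{q^2}, regarded as maps into F_{q^4}. *)
Definition Tr2 (R : nzRingType) (q : nat) (z : R) : R := z + z ^+ (q ^ 2)%N.
Definition N2 (R : nzRingType) (q : nat) (z : R) : R := z ^+ (q ^ 2 + 1)%N.

Definition nonzero_square_in (F : fieldType) (L : fieldExtType F)
    (E : {subfield L}) (x : L) : Prop :=
  exists y : L, [/\ y \in E, y != 0 & x = y ^+ 2].

(* Main.v *)
Require Import Defs.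
From HB Require Import structures.
From mathcomp Require Import all_boot all_order all_algebra all_field.
From mathcomp Require Import ring zify.

Set Implicit Arguments.
Unset Strict Implicit.
Unset Printing Implicit Defensive.

Import GRing.Theory.
Local Open Scope ring_scope.

(** Write s for the Frobenius z |-> z^q, t for s \o s, F_q and K = F_{q^2} for
    the fixed fields of s and t, Tr and N for the trace and norm of t.  The
    function is f(x) = s(N x) + a N(x) + b x^2, a quadratic map over F_q, so
    it is planar as soon as its polarization
      B(x, c) = s(T) + a T + 2 b x c,   where T = Tr(x t(c)),
    vanishes only when x = 0 or c = 0.

    Suppose that B(x, c) = 0 with x, c nonzero.  Then T is nonzero, because
    2 b x c is, and the norm of s(T) + a T = - 2 b x c involves x and c only
    through T and N(x t(c)).  With the antitrace w = x t(c) - t(x) c, for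
    which w^2 = T^2 - 4 N(x t(c)), this reads
      N(b) w^2 = (N(b) - N(a)) T^2 - Tr(a) T s(T) - s(T)^2.
    In both cases there are theta in K and e in F_q (theta = Tr(a) and e = 1,
    or e = 0) with Tr(a) = e theta and N(b) - N(a) = - theta / s(theta), so that
    the right-hand side is - theta h(T), where
      h(T) = T^2 / s(theta) + e T s(T) + s(T)^2 / theta
    is fixed by s, since s exchanges its outer terms.  As N(b) theta = y^2 with
    y in K, the element g = y w / theta satisfies g^2 = - h(T), which lies in
    F_q; hence s(g) = g or s(g) = - g, and t(g) = g.  But t(w) = - w gives
    t(g) = - g, so g = 0 and h(T) = 0: see [polar_trivial_kernel].

    It remains to see that h has no nonzero root T in K.  When e = 1, the ratio
    r = s(T) / T solves a quadratic equation whose discriminant is a nonzero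
    square of F_q, and this is incompatible with r s(r) = 1
    ([trace_form_neq0]).  When e = 0, a root gives (T^2 theta)^(q-1) = - 1, and
    raising to the power (q+1)/2 contradicts the prescribed quadratic character
    of theta ([twisted_trace_form_neq0]). *)

(** * Fields with an automorphism of order dividing four *)

(** The square roots in L of an element of the fixed field of s are fixed by
    s \o s, whereas g = y w / theta, built in the proof, is such a root and is
    negated by s \o s.  The condition that N(b) theta be the square of some y
    fixed by s \o s is what makes y w / theta inherit the sign change of w. *)
Lemma polar_trivial_kernel (L : fieldType) (s : {rmorphism L -> L})
    (s4 : forall z, s (s (s (s z))) = z) (two_neq0 : 2%:R != 0 :> L)
    (a b theta e y : L) (b_neq0 : b != 0) (theta_neq0 : theta != 0)
    (y_neq0 : y != 0) (s2theta : s (s theta) = theta) (s2y : s (s y) = y)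
    (se : s e = e) (tr_a : a + s (s a) = e * theta)
    (norm_b : b * s (s b) = a * s (s a) - theta / s theta)
    (norm_b_theta : b * s (s b) * theta = y ^+ 2)
    (form_neq0 : forall z, s (s z) = z -> z != 0 ->
       z ^+ 2 / s theta + e * z * s z + s z ^+ 2 / theta != 0)
    (x c : L) (x_neq0 : x != 0) (c_neq0 : c != 0) :
  s (x * s (s c) + c * s (s x)) + a * (x * s (s c) + c * s (s x))
    + 2%:R * b * x * c != 0.
Proof.
set T := x * s (s c) + c * s (s x); apply/eqP => B0.
have TE : T = x * s (s c) + c * s (s x) by [].
clearbody T.
have s2T : s (s T) = T by rewrite TE !(rmorphD, rmorphM) /= !s4; ring.
have T_neq0 : T != 0.
  apply/eqP => T0; move/eqP: B0.
  by rewrite T0 rmorph0 mulr0 !add0r !mulf_eq0 (negPf two_neq0) (negPf b_neq0)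
    (negPf x_neq0) (negPf c_neq0).
have stheta_neq0 : s theta != 0 by rewrite fmorph_eq0.
set h := T ^+ 2 / s theta + e * T * s T + s T ^+ 2 / theta.
have h_neq0 : h != 0 by exact: form_neq0.
have sh : s h = h.
  rewrite /h !(rmorphD, rmorphM, fmorphV, rmorphXn) /= s2T s2theta se.
  by rewrite (mulrAC e) addrC addrA addrAC.
set w := x * s (s c) - c * s (s x).
have s2w : s (s w) = - w by rewrite /w !(rmorphB, rmorphM) /= !s4; ring.
have E1 : s T + a * T = - (2%:R * b * x * c).
  by apply/eqP; rewrite -addr_eq0 B0.
have E2 : s T + s (s a) * T = - (2%:R * s (s b) * s (s x) * s (s c)).
  have := congr1 (fun z => s (s z)) E1.
  by rewrite 2!rmorphN !rmorphM !rmorph_nat /= !rmorphD !rmorphM /= s2T.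
have w2 : b * s (s b) * w ^+ 2 = - (theta * h).
  have -> : b * s (s b) * w ^+ 2 =
      b * s (s b) * T ^+ 2 - (s T + a * T) * (s T + s (s a) * T).
    by rewrite E1 E2 /w TE; ring.
  have -> : (s T + a * T) * (s T + s (s a) * T) =
      s T ^+ 2 + (a + s (s a)) * (T * s T) + a * s (s a) * T ^+ 2 by ring.
  rewrite tr_a norm_b /h.
  move: (s T) (s theta) (s (s a)) stheta_neq0 => sT stheta s2a stheta_neq0.
  by field; rewrite theta_neq0.
set g := y * w / theta.
have g2 : g ^+ 2 = - h.
  apply: (mulfI theta_neq0); rewrite mulrN -w2 /g !exprMn -norm_b_theta.
  by field.
have s2g : s (s g) = - g.
  by rewrite /g !(rmorphM, fmorphV) /= s2y s2w s2theta mulrN mulNr.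
have s2g' : s (s g) = g.
  have : s g ^+ 2 == g ^+ 2 by rewrite -rmorphXn g2 rmorphN sh.
  by rewrite eqf_sqr => /orP[] /eqP sg; rewrite !sg ?rmorphN ?sg ?opprK.
have g0 : g = 0.
  apply/eqP; have : 2%:R * g == 0 by rewrite mulr_natl mulr2n -{1}s2g' s2g addNr.
  by rewrite mulf_eq0 (negPf two_neq0).
by case/eqP: h_neq0; apply: oppr_inj; rewrite -g2 g0 expr0n oppr0.
Qed.

(** For a root z, the ratio r = s z / z is theta (d - 1) / 2 for one of the two
    square roots d of the discriminant 1 - 4 / (theta * s theta).
    Since r * s r = 1 while theta * s theta * (1 - d^2) = 4, the factors 1 - d
    and 1 + d agree, that is d = 0.  The coefficient 1 is the e of
    [polar_trivial_kernel]. *)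
Lemma trace_form_neq0 (L : fieldType) (s : {rmorphism L -> L})
    (two_neq0 : 2%:R != 0 :> L) (theta d z : L) (theta_neq0 : theta != 0)
    (d_neq0 : d != 0) (sd : s d = d)
    (discr : 1 - 4%:R / (theta * s theta) = d ^+ 2)
    (s2z : s (s z) = z) (z_neq0 : z != 0) :
  z ^+ 2 / s theta + 1 * z * s z + s z ^+ 2 / theta != 0.
Proof.
apply/eqP => h0.
have stheta_neq0 : s theta != 0 by rewrite fmorph_eq0.
have sz_neq0 : s z != 0 by rewrite fmorph_eq0.
have norm_theta : theta * s theta * (1 - d ^+ 2) = 4%:R.
  by rewrite -discr opprB addrC subrK mulrC divfK // mulf_neq0.
have sq : (2%:R * s z + theta * z) ^+ 2 = (theta * d * z) ^+ 2.
  have -> : (theta * d * z) ^+ 2 = theta ^+ 2 * d ^+ 2 * z ^+ 2 by ring.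
  rewrite -discr; apply/eqP; rewrite -subr_eq0; apply/eqP.
  rewrite -[RHS](mulr0 (4%:R * theta)) -h0.
  move: (s z) (s theta) stheta_neq0 => sz stheta stheta_neq0.
  by field; rewrite theta_neq0.
(* Replacing d by - d selects the root of the quadratic equation. *)
wlog root_eq : d d_neq0 sd {discr sq} norm_theta /
    2%:R * s z + theta * z = theta * d * z.
  move=> IH; have := sq; move/eqP; rewrite eqf_sqr => /orP[] /eqP E.
    exact: (IH d).
  by apply: (IH (- d)); rewrite ?oppr_eq0 ?rmorphN ?sd ?sqrrN // E; ring.
have E1 : 2%:R * s z = theta * (d - 1) * z.
  by apply: (addIr (theta * z)); rewrite root_eq; ring.
have E2 : 2%:R * z = s theta * (d - 1) * s z.
  have := congr1 s E1.
  by rewrite !(rmorphM, rmorphB, rmorph1, rmorph_nat) /= s2z sd.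
have norm_r : theta * s theta * (d - 1) ^+ 2 = 4%:R.
  apply: (mulIf (mulf_neq0 z_neq0 sz_neq0)).
  transitivity ((theta * (d - 1) * z) * (s theta * (d - 1) * s z)); first by ring.
  by rewrite -E1 -E2; ring.
have d1 : d - 1 != 0.
  apply/eqP => d1; move/eqP: norm_r; rewrite d1 expr0n mulr0 eq_sym.
  by rewrite (natrM _ 2 2) mulf_eq0 (negPf two_neq0).
have : 2%:R * (theta * s theta * (d - 1) * d) == 0.
  rewrite -(subrr 4%:R) -[X in _ == X - _]norm_r -norm_theta.
  by apply/eqP; ring.
by rewrite !mulf_eq0 (negPf two_neq0) (negPf theta_neq0) (negPf stheta_neq0)
  (negPf d1) (negPf d_neq0).
Qed.

(** * Frobenius powers *)

(** A root z makes u = z^2 theta satisfy u^(q-1) = - 1.  Since z^(q^2-1) = 1,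
    the power u^((q^2-1)/2) is the quadratic character of theta, which would
    then be (-1)^((q+1)/2), the opposite of the prescribed value. *)
Lemma twisted_trace_form_neq0 (L : fieldType) (q : nat) (q_odd : odd q)
    (two_neq0 : 2%:R != 0 :> L) (theta z : L) (theta_neq0 : theta != 0)
    (theta_char : theta ^+ ((q ^ 2 - 1) %/ 2) = (- 1) ^+ ((q - 1) %/ 2))
    (zq2 : z ^+ (q ^ 2) = z) (z_neq0 : z != 0) :
  z ^+ 2 / theta ^+ q + 0 * z * z ^+ q + (z ^+ q) ^+ 2 / theta != 0.
Proof.
apply/eqP; rewrite !mul0r addr0 => h0.
(* From here on the number of elements of F_q is q.+1 = 2 m + 1. *)
case: q q_odd theta_char zq2 h0 => // q; rewrite /= => q_even.
rewrite subSS subn0 => theta_char zq2 h0.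
have [m q_eq] : exists m, q = (m * 2)%N.
  by exists q./2; rewrite muln2 -[LHS]odd_double_half (negPf q_even).
have uq : (z ^+ 2 * theta) ^+ q = - 1.
  have nz : z ^+ 2 * theta != 0 by rewrite mulf_neq0 ?expf_neq0.
  apply: (mulIf nz); rewrite -exprSr exprMn mulN1r exprAC.
  apply/eqP; rewrite -addr_eq0; apply/eqP.
  rewrite -[RHS](mulr0 (theta * theta ^+ q.+1)) -h0.
  have : theta ^+ q.+1 != 0 by rewrite expf_neq0.
  move: (z ^+ q.+1) (theta ^+ q.+1) => zq thq thq_neq0.
  by field; rewrite theta_neq0.
have half : ((q.+1 ^ 2 - 1) %/ 2 = q * m.+1)%N.
  by rewrite q_eq (_ : (_ - 1 = m * 2 * m.+1 * 2)%N) ?mulnK //; nia.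
have z1 : z ^+ (q * m.+1 * 2) = 1.
  apply: (mulIf z_neq0); rewrite mul1r -exprSr -[RHS]zq2; congr (_ ^+ _).
  by rewrite q_eq; nia.
have : theta ^+ (q * m.+1) = (- 1) ^+ m.+1.
  by rewrite -uq -exprM exprMn -exprM (mulnC 2) z1 mul1r.
rewrite -half theta_char q_eq mulnK // exprS mulN1r => /eqP.
by rewrite -addr_eq0 -mulr2n -mulr_natl mulf_eq0 (negPf two_neq0) signr_eq0.
Qed.

Lemma frobenius_power_rmorphism (L : fieldType) (q : nat)
    (q_pchar : [pchar L].-nat q) :
  exists s : {rmorphism L -> L}, forall z, s z = z ^+ q.
Proof.
pose f (z : L) := z ^+ q.
have fB : zmod_morphism f by move=> u v; rewrite /f exprDn_pchar // exprNn_pchar.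
have fM : monoid_morphism f by split=> [|u v]; rewrite /f ?expr1n ?exprMn.
pose fm : {rmorphism L -> L} := HB.pack f
  (GRing.isZmodMorphism.Build _ _ f fB) (GRing.isMonoidMorphism.Build _ _ f fM).
by exists fm.
Qed.

Lemma injective_bijective_fieldExt (F : finFieldType) (L : fieldExtType F)
    (f : L -> L) : injective f -> bijective f.
Proof. exact: (@injF_bij (finvect_type L)). Qed.

Theorem theorem6 (p k q : nat) (p_prime : prime p) (p_odd : odd p)
    (k_gt0 : (0 < k)%N) (q_def : q = (p ^ k)%N)
    (Fq : finFieldType) (card_Fq : #|Fq| = q)
    (L : fieldExtType Fq) (dim_L : \dim {:L} = 4%N)
    (K : {subfield L}) (dim_K : \dim K = 2%N)
    (a b : L) (a_neq0 : a != 0) (b_neq0 : b != 0) :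
  [/\ Tr2 q a != 0,
      N2 q b = N2 q a - Tr2 q a ^ (1 - q%:Z),
      nonzero_square_in 1%AS (1 - 4%:R * Tr2 q a ^ (- 1 - q%:Z)) &
      nonzero_square_in K (N2 q b * Tr2 q a)]
  \/
  (Tr2 q a = 0 /\
   exists theta : L,
     [/\ theta \in K /\ theta != 0,
         theta ^+ ((q ^ 2 - 1) %/ 2)%N = (- 1) ^+ ((q - 1) %/ 2)%N,
         N2 q b = N2 q a - theta ^ (1 - q%:Z) &
         nonzero_square_in K (N2 q b * theta)]) ->
  planar (fun x : L =>
    x ^+ (q ^ 3 + q)%N + a * x ^+ (q ^ 2 + 1)%N + b * x ^+ 2).
Proof.
have pcharL : p \in [pchar L].
  by rewrite pchar_lalg (@card_finPcharP _ p k) // card_Fq q_def.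
have two_neq0 : 2%:R != 0 :> L.
  rewrite -(dvdn_pcharf pcharL) (dvdn_prime2 p_prime) //.
  by apply: contraTneq p_odd => ->.
have q_odd : odd q by rewrite q_def oddX p_odd orbT.
have q_pchar : [pchar L].-nat q.
  by rewrite q_def (eq_pnat _ (pcharf_eq pcharL)) pnatX pnat_id.
have [s sE] := frobenius_power_rmorphism q_pchar.
have s2E z : s (s z) = z ^+ (q ^ 2) by rewrite !sE -exprM mulnn.
have s4 z : s (s (s (s z))) = z.
  rewrite !s2E -exprM -expnD; apply/eqP.
  by have := Fermat's_little_theorem {:L}%AS z; rewrite dim_L card_Fq memvf.
have fixK z : z \in K -> s (s z) = z.
  by rewrite Fermat's_little_theorem dim_K card_Fq s2E => /eqP.
have fixF z : z \in 1%AS -> s z = z.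
  by rewrite Fermat's_little_theorem dimv1 card_Fq expn1 sE => /eqP.
have TrE z : Tr2 q z = z + s (s z) by rewrite /Tr2 s2E.
have NE z : N2 q z = z * s (s z) by rewrite /N2 s2E addn1 exprS.
have powB z : z != 0 -> z ^ (1 - q%:Z) = z / s z.
  by move=> z_neq0; rewrite expfzDr // expr1z sE -exprnN.
have powN z : z != 0 -> z ^ (- 1 - q%:Z) = (z * s z)^-1.
  by move=> z_neq0; rewrite expfzDr // exprN1 sE -exprnN invfM.
move=> cond.
suff [theta [e [y [theta_neq0 y_neq0 [s2theta s2y se] [tr_a norm_b nbt] h]]]] :
    exists theta e y, [/\ theta != 0, y != 0,
      [/\ s (s theta) = theta, s (s y) = y & s e = e],
      [/\ a + s (s a) = e * theta,
          b * s (s b) = a * s (s a) - theta / s theta &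
          b * s (s b) * theta = y ^+ 2] &
      forall z, s (s z) = z -> z != 0 ->
        z ^+ 2 / s theta + e * z * s z + s z ^+ 2 / theta != 0].
  move=> c c_neq0; apply: injective_bijective_fieldExt => u v /= /eqP.
  have fE z : z ^+ (q ^ 3 + q) + a * z ^+ (q ^ 2 + 1) + b * z ^+ 2 =
      s (z * s (s z)) + a * (z * s (s z)) + b * z ^+ 2.
    by rewrite -!NE sE /N2 -exprM mulnDl mul1n -expnSr.
  rewrite !fE; case: (eqVneq u v) => // u_neq_v.
  rewrite -subr_eq0 => /eqP E.
  have uv_neq0 : u - v != 0 by rewrite subr_eq0.
  have := polar_trivial_kernel s4 two_neq0 b_neq0 theta_neq0 y_neq0 s2theta s2y
            se tr_a norm_b nbt h uv_neq0 c_neq0.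
  case/eqP; rewrite -[RHS]E !(rmorphD, rmorphB, rmorphM) /=.
  by ring.
case: cond => [[Tr_neq0 norm_b [d [dF d_neq0 discr]] [y [yK y_neq0 nbt]]]|].
  exists (Tr2 q a), 1, y; split=> //.
  - by split; [rewrite TrE !rmorphD /= s4 addrC | exact: fixK | exact: rmorph1].
  - by rewrite mul1r -!NE -powB // -TrE.
  move=> z; apply: trace_form_neq0 => //; first exact: d_neq0; first exact: fixF.
  by rewrite -powN.
case=> Tr0 [theta [[thetaK theta_neq0] theta_char norm_b [y [yK y_neq0 nbt]]]].
exists theta, 0, y; split=> //.
- by split; [exact: fixK | exact: fixK | exact: rmorph0].
- by rewrite mul0r -!NE -powB // -TrE.
by move=> z; rewrite s2E !sE; apply: twisted_trace_form_neq0.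
Qed.
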